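(* There exists a sparsity pattern $\mathcal{G}$ (for some positive integers $n$ and $m$) that is structurally averaged controllable, but is neither structurally controllable nor structurally ensemble controllable.
   Context: Let $n,m$ be positive integers and $\Sigma=[0,1]$. Sparsity patterns. A sparsity pattern is a directed graph $\mathcal{G}=(V,\mathcal{E})$ (self-loops allowed) with node set $V=\{\alpha_1,\ldots,\alpha_n,\beta_1,\ldots,\beta_m\}$ such that no $\beta$-node has an incoming edge. Compliant pairs. A pair $(A,B)$, with $A$ of size $n\times n$ and $B$ of size $n\times m$, is compliant with $\mathcal{G}$ if: the $(j,i)$ entry of $A$ is zero (identically zero, if $A$ is a function) whenever $(\alpha_i,\alpha_j)\notin\mathcal{E}$, and the $(j,i)$ entry of $B$ is (identically) zero whenever $(\beta_i,\alpha_j)\notin\mathcal{E}$. In the ensemble setting, $\mathbb{V}(\mathcal{G})$ denotes the vector space of all pairs $(A,B)\in \mathrm{C}^0(\Sigma,\mathbb{R}^{n\times n}\times\mathbb{R}^{n\times m})$ compliant with $\mathcal{G}$. Ensemble system. Given continuous $A:\Sigma\to\mathbb{R}^{n\times n}$ and $B:\Sigma\to\mathbb{R}^{n\times m}$, the associated linear ensemble system is $$\frac{\partial}{\partial t}x(t,\sigma)=A(\sigma)x(t,\sigma)+B(\sigma)u(t),\qquad \sigma\in\Sigma,\ t\ge 0, \tag{E}$$ with $x(t,\sigma)\in\mathbb{R}^n$ and a control input $u(t)\in\mathbb{R}^m$ that does not depend on $\sigma$. Averaged controllability. System (E) is averaged controllable if for any $x_0\in\mathbb{R}^n$ and any initial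 profile $x(0,\cdot)\in \mathrm{C}^0(\Sigma,\mathbb{R}^n)$ with $\int_0^1 x(0,\sigma)\,\mathrm{d}\sigma=x_0$, any target $x^*\in\mathbb{R}^n$, and any time $T>0$, there is $u\in \mathrm{L}^1([0,T];\mathbb{R}^m)$ such that $\int_0^1 x(T,\sigma)\,\mathrm{d}\sigma=x^*$. $\mathrm{L}^p$-controllability ($1\le p\le\infty$). System (E) is $\mathrm{L}^p$-controllable if for any initial profile $x(0,\cdot)\in\mathrm{C}^0(\Sigma,\mathbb{R}^n)$, any target profile $x^*\in \mathrm{C}^0(\Sigma,\mathbb{R}^n)$, any $\epsilon>0$ and any $T>0$, there is $u\in \mathrm{L}^1([0,T];\mathbb{R}^m)$ such that $\|x(T,\cdot)-x^*\|_{\mathrm{L}^p}<\epsilon$. Structural notions. - $\mathcal{G}$ is structurally controllable if there is a pair of constant matrices $(A,B)\in\mathbb{R}^{n\times n}\times\mathbb{R}^{n\times m}$ compliant with $\mathcal{G}$ such that the linear time-invariant system $\dot x(t)=Ax(t)+Bu(t)$ is controllable. - $\mathcal{G}$ is structurally ensemble controllable if there is a pair $(A,B)\in\mathbb{V}(\mathcal{G})$ (continuous functions on $\Sigma$) such that (E) is $\mathrm{L}^p$-controllable for some $p\in[1,\infty]$ (this notion is known not to depend on $p$). - $\mathcal{G}$ is structurally averaged controllable if there is a pair $(A,B)\in\mathbb{V}(\mathcal{G})$ (continuous functions on $\Sigma$) such that (E) is averaged controllable. *)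

(* Defs.v *)
From HB Require Import structures.
From mathcomp Require Import all_boot all_order all_algebra.
From mathcomp Require Import all_classical all_reals all_analysis.

Set Implicit Arguments.
Unset Strict Implicit.
Unset Printing Implicit Defensive.

Import Order.TTheory GRing.Theory Num.Theory.
Import numFieldNormedType.Exports.

Local Open Scope classical_set_scope.
Local Open Scope ring_scope.

(* Nodes are 'I_n + 'I_m: inl i is the i-th alpha-node (state), inr i the i-th
   beta-node (input). *)
Record sparsity_pattern (n m : nat) := SparsityPattern {
  edge : rel ('I_n + 'I_m)%type ;
  no_edge_to_input : forall v (j : 'I_m), ~~ edge v (inr j) }.

Definition compliant (R : realType) (n m : nat) (G : sparsity_pattern n m)
    (A : 'M[R]_n) (B : 'M[R]_(n, m)) : Prop :=
  (forall i j : 'I_n, ~~ edge G (inl i) (inl j) -> A j i = 0) /\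
  (forall (i : 'I_m) (j : 'I_n), ~~ edge G (inr i) (inl j) -> B j i = 0).

(* The space V(G).  Functions on Sigma = [0, 1] are represented by total
   functions on R whose values outside [0, 1] are never used. *)
Definition ensemble_compliant (R : realType) (n m : nat)
    (G : sparsity_pattern n m) (A : R -> 'M[R]_n) (B : R -> 'M[R]_(n, m))
    : Prop :=
  [/\ {within `[0, 1], continuous A}, {within `[0, 1], continuous B} &
      forall s : R, s \in `[0, 1] -> compliant G (A s) (B s)].

Definition vintegral (R : realType) (n : nat) (D : set R) (f : R -> 'cV[R]_n)
    : 'cV[R]_n :=
  \col_i (\int[@lebesgue_measure R]_(s in D) f s i 0)%R.

Definition L1_control (R : realType) (m : nat) (T : R) (u : R -> 'cV[R]_m)
    : Prop :=
  forall i : 'I_m,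
    (@lebesgue_measure R).-integrable `[0, T] (fun t => (u t i 0)%:E).

(* Caratheodory solution on [0, T] of x' = A x + B u, x(0) = x0. As u is only
   integrable, the equation is read in its integrated form. *)
Definition trajectory (R : realType) (n m : nat) (A : 'M[R]_n)
    (B : 'M[R]_(n, m)) (T : R) (u : R -> 'cV[R]_m) (x0 : 'cV[R]_n)
    (x : R -> 'cV[R]_n) : Prop :=
  {within `[0, T], continuous x} /\
  (forall t : R, t \in `[0, T] ->
     x t = x0 + vintegral `[0, t] (fun s : R => A *m x s + B *m u s)).

Definition controllable (R : realType) (n m : nat) (A : 'M[R]_n)
    (B : 'M[R]_(n, m)) : Prop :=
  forall (x0 xT : 'cV[R]_n) (T : R), 0 < T ->
    exists u : R -> 'cV[R]_m, exists x : R -> 'cV[R]_n,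
      [/\ L1_control T u, trajectory A B T u x0 x & x T = xT].

(* x t s is the state at time t of the system with parameter s. *)
Definition ensemble_trajectory (R : realType) (n m : nat) (A : R -> 'M[R]_n)
    (B : R -> 'M[R]_(n, m)) (T : R) (u : R -> 'cV[R]_m) (x0 : R -> 'cV[R]_n)
    (x : R -> R -> 'cV[R]_n) : Prop :=
  forall s : R, s \in `[0, 1] -> trajectory (A s) (B s) T u (x0 s) (x^~ s).

Definition averaged_controllable (R : realType) (n m : nat) (A : R -> 'M[R]_n)
    (B : R -> 'M[R]_(n, m)) : Prop :=
  forall (x0 : 'cV[R]_n) (xi : R -> 'cV[R]_n) (xT : 'cV[R]_n) (T : R),
    {within `[0, 1], continuous xi} -> vintegral `[0, 1] xi = x0 -> 0 < T ->
    exists u : R -> 'cV[R]_m, exists x : R -> R -> 'cV[R]_n,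
      [/\ L1_control T u, ensemble_trajectory A B T u xi x &
          vintegral `[0, 1] (x T) = xT].

Definition euclidean_norm (R : realType) (n : nat) (v : 'cV[R]_n) : R :=
  Num.sqrt (\sum_i v i 0 ^+ 2).

(* The L^p([0, 1]; R^n) norm. 'N[mu]_p integrates over all of R, so the
   integrand is extended by 0 outside [0, 1]. *)
Definition profile_norm (R : realType) (n : nat) (p : \bar R)
    (f : R -> 'cV[R]_n) : \bar R :=
  Lnorm (@lebesgue_measure R) p
    ((fun s : R => (euclidean_norm (f s))%:E) \_ `[0, 1]).

Definition Lp_controllable (R : realType) (n m : nat) (p : \bar R)
    (A : R -> 'M[R]_n) (B : R -> 'M[R]_(n, m)) : Prop :=
  forall (xi xT : R -> 'cV[R]_n) (eps T : R),
    {within `[0, 1], continuous xi} -> {within `[0, 1], continuous xT} ->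
    0 < eps -> 0 < T ->
    exists u : R -> 'cV[R]_m, exists x : R -> R -> 'cV[R]_n,
      [/\ L1_control T u, ensemble_trajectory A B T u xi x &
          (profile_norm p (fun s : R => x T s - xT s)%R < eps%:E)%E].

Definition structurally_controllable (R : realType) (n m : nat)
    (G : sparsity_pattern n m) : Prop :=
  exists (A : 'M[R]_n) (B : 'M[R]_(n, m)), compliant G A B /\ controllable A B.

Definition structurally_ensemble_controllable (R : realType) (n m : nat)
    (G : sparsity_pattern n m) : Prop :=
  exists (A : R -> 'M[R]_n) (B : R -> 'M[R]_(n, m)),
    ensemble_compliant G A B /\
    exists p : \bar R, (1 <= p)%E /\ Lp_controllable p A B.

Definition structurally_averaged_controllable (R : realType) (n m : nat)
    (G : sparsity_pattern n m) : Prop :=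
  exists (A : R -> 'M[R]_n) (B : R -> 'M[R]_(n, m)),
    ensemble_compliant G A B /\ averaged_controllable A B.

(* Main.v *)
Require Import Defs.
From mathcomp Require Import all_boot all_order all_algebra.
From mathcomp Require Import all_classical all_reals all_analysis.
From mathcomp Require Import measurable_realfun ess_sup_inf.
From mathcomp Require Import ring lra.

Set Implicit Arguments.
Unset Strict Implicit.
Unset Printing Implicit Defensive.

(** The witness has three state nodes and two inputs: both inputs feed a hub
    (state node [0]), the hub feeds two leaves (state nodes [1] and [2]), and
    there is no other edge.

    For any compliant pair, each leaf [i] obeys [x_i' = A_i0 x_0].  Hence in
    time [T] the two leaves move together by the multiple
    [int_0^T x_0] of the vector [(A_10, A_20)] ([star_leaf_shift]): for a fixed
    parameter the leaf part of the state can only be moved along a line.  This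
    rules out controllability of a single system at once.  It also rules out
    ensemble controllability in any Lp norm.  With zero initial profile, the
    target whose leaf part is [(- A_20, A_10)], orthogonal to that line, is
    missed at every parameter by at least the length of [(A_10, A_20)]; as the
    error can be made arbitrarily small, this length vanishes almost
    everywhere, so that the leaves cannot move at almost every parameter, and
    then a constant nonzero leaf target cannot be approximated either.

    Averaging over the parameter removes the obstruction, because the line
    varies with the parameter.  Put [w(s) = 2 s - 1], which has mean [0] and
    mean square [1/3], let the leaf gains be [1] and [w] and the input gains
    [1] and [w].  As [A(s)^2 = 0], a control [u_j = V_j''] with
    [V_j(0) = V_j'(0) = 0] adds to the state at time [T] the vector with entries
    [V_0' + w V_1'], [V_0 + w V_1] and [w V_0 + w^2 V_1], whose mean is
    [(V_0', V_0, V_1 / 3)].  It remains to prescribe [V_0'], [V_0] and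
    [V_1] at time [T], which cubic polynomials do
    ([double_integrator_steering]). *)

Import Order.TTheory GRing.Theory Num.Theory.
Import numFieldNormedType.Exports.

Local Open Scope classical_set_scope.
Local Open Scope ring_scope.

(** * Continuity and integrals *)

Lemma cvg_matrix (K : numFieldType) (T : Type) (F : set_system T) (m n : nat)
    (f : T -> 'M[K]_(m, n)) (M : 'M[K]_(m, n)) :
  Filter F -> (forall i j, f x i j @[x --> F] --> M i j) -> f @ F --> M.
Proof.
move=> FF fM P [Q MQ QP].
apply: (filterS (P := fun x => forall i j, Q i j (f x i j))).
  by move=> x Qx; apply: QP.
by apply: filter_forall => i; apply: filter_forall => j; apply: fM; exact: MQ.
Qed.

Lemma within_continuous_coord (R : realType) (D : set R) (m n : nat)
    (f : R -> 'M[R]_(m, n)) (i : 'I_m) (j : 'I_n) :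
  {within D, continuous f} -> {within D, continuous (fun x => f x i j)}.
Proof.
move=> cf; apply: (@within_continuous_comp _ _ _ D f (fun M => M i j)) => //.
by move=> M _; exact: coord_continuous.
Qed.

Lemma within_continuous_mx (R : realType) (D : set R) (m n : nat)
    (f : R -> 'M[R]_(m, n)) :
  (forall i j, {within D, continuous (fun x => f x i j)}) ->
  {within D, continuous f}.
Proof. by move=> cf x; apply: cvg_matrix => i j; exact: cf. Qed.

Lemma continuous_poly_mx (R : realType) (m n : nat)
    (P : 'I_m -> 'I_n -> {poly R}) :
  continuous (fun t => \matrix_(i, j) (P i j).[t]).
Proof.
move=> t; apply: cvg_matrix => i j; rewrite mxE.
under eq_fun do rewrite mxE.
exact: continuous_horner.
Qed.

Lemma integrable_itv (R : realType) (a b : R) (f : R -> R) :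
  {within `[a, b], continuous f} ->
  (@lebesgue_measure R).-integrable `[a, b] (EFin \o f).
Proof.
by move=> cf; apply: continuous_compact_integrable => //; exact: segment_compact.
Qed.

Lemma Rintegral_deriv_poly (R : realType) (P : {poly R}) (a b : R) : a <= b ->
  \int[@lebesgue_measure R]_(s in `[a, b]) P^`().[s] = P.[b] - P.[a].
Proof.
rewrite le_eqVlt => /predU1P[<-|ab].
  by rewrite set_itv1 Rintegral_set1 subrr.
rewrite /Rintegral (@continuous_FTC2 _ _ (horner P)) //.
- exact/continuous_subspaceT/continuous_horner.
- split; first by move=> x _; exact: derivable_horner.
  + exact/cvg_at_right_filter/continuous_horner.
  + exact/cvg_at_left_filter/continuous_horner.
- by move=> x _; rewrite -derivE.
Qed.

Lemma Rintegral01_add_deriv_poly (R : realType) (f : R -> R) (P : {poly R}) :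
  {within `[0, 1], continuous f} ->
  \int[@lebesgue_measure R]_(s in `[0, 1]) (f s + P^`().[s]) =
  \int[@lebesgue_measure R]_(s in `[0, 1]) f s + (P.[1] - P.[0]).
Proof.
move=> cf; rewrite RintegralD //.
- by rewrite Rintegral_deriv_poly.
- exact: integrable_itv.
- exact/integrable_itv/continuous_subspaceT/continuous_horner.
Qed.

(** All the trajectories needed for averaged controllability have polynomial
    coordinates, so that the integral equation reduces to an identity between
    formal derivatives. *)
Lemma poly_trajectory (R : realType) (n m : nat) (A : 'M[R]_n)
    (B : 'M[R]_(n, m)) (T : R) (u : R -> 'cV[R]_m) (P : 'I_n -> {poly R})
    (x := fun t => \col_i (P i).[t]) :
  (forall t i, (A *m x t + B *m u t) i 0 = (P i)^`().[t]) ->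
  trajectory A B T u (x 0) x.
Proof.
move=> dx; split.
  exact/continuous_subspaceT/(@continuous_poly_mx _ _ _ (fun i _ => P i)).
move=> t; rewrite in_itv /= => /andP[t0 _]; apply/colP => i; rewrite !mxE.
under eq_Rintegral do rewrite dx.
by rewrite Rintegral_deriv_poly // addrC subrK.
Qed.

(** The error of an ensemble trajectory at time [T] is not known to be a
    measurable function of the parameter.  Monotonicity is therefore read off
    the definition of the integral of a nonnegative function as a supremum over
    the simple functions below it. *)
Lemma le_Lnorm (d : measure_display) (T : measurableType d) (R : realType)
    (mu : {measure set T -> \bar R}) (p : \bar R) (f g : T -> \bar R) :
  (0 < p)%E -> (forall x, `|f x| <= `|g x|)%E ->
  (Lnorm mu p f <= Lnorm mu p g)%E.
Proof.
rewrite unlock; case: p => [r| |] //= p0 fg.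
- rewrite lte_fin in p0.
  have le_pow x : (`|f x| `^ r <= `|g x| `^ r)%E.
    by apply: gt0_ler_poweR => //; rewrite ?in_itv /= ?abse_ge0 ?leey // ltW.
  apply: gt0_ler_poweR.
  + by rewrite invr_ge0 ltW.
  + by rewrite in_itv /= integral_ge0 ?leey// => x _; exact: poweR_ge0.
  + by rewrite in_itv /= integral_ge0 ?leey// => x _; exact: poweR_ge0.
  rewrite !ge0_integralTE //; try by move=> x; exact: poweR_ge0.
  apply: ge_ereal_sup => _ [h hf <-]; apply: ereal_sup_ubound; exists h => // x.
  exact: le_trans (hf x) (le_pow x).
- case: ifP => // _; apply: le_ess_sup; exact: nearW.
Qed.

(** * The star pattern and its leaves *)

Definition star_edge (v w : 'I_3 + 'I_2) : bool :=
  match v, w with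
  | inl i, inl j => (i == 0) && (j != 0)
  | inr _, inl j => j == 0
  | _, inr _ => false
  end.

Lemma star_edge_to_input v (j : 'I_2) : ~~ star_edge v (inr j).
Proof. by case: v. Qed.

Definition star : sparsity_pattern 3 2 := SparsityPattern star_edge_to_input.

Lemma star_hub_dynamics (R : realType) (A : 'M[R]_3) (B : 'M[R]_(3, 2))
    (x : 'cV[R]_3) (u : 'cV[R]_2) :
  compliant star A B ->
  (A *m x + B *m u) 0 0 = B 0 0 * u 0 0 + B 0 1 * u 1 0.
Proof.
move=> [A0 _]; rewrite !mxE big1 => [|j _].
  rewrite add0r !big_ord_recl big_ord0 addr0.
  by congr (_ + B _ _ * u _ _); exact/val_inj.
by rewrite A0 ?mul0r //= andbF.
Qed.

Lemma star_leaf_dynamics (R : realType) (A : 'M[R]_3) (B : 'M[R]_(3, 2))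
    (x : 'cV[R]_3) (u : 'cV[R]_2) (i : 'I_3) :
  compliant star A B -> i != 0 -> (A *m x + B *m u) i 0 = A i 0 * x 0 0.
Proof.
move=> [A0 B0] i0; rewrite !mxE (bigD1 0) //= big1 => [|j j0].
  by rewrite big1 ?addr0 // => j _; rewrite B0 ?mul0r.
by rewrite A0 ?mul0r //= (negbTE j0).
Qed.

(** The same [I], the integral of the hub state, serves both leaves: this is the
    source of both negative results. *)
Lemma star_leaf_shift (R : realType) (A : 'M[R]_3) (B : 'M[R]_(3, 2)) (T : R)
    (u : R -> 'cV[R]_2) (x0 : 'cV[R]_3) (x : R -> 'cV[R]_3) :
  compliant star A B -> 0 <= T -> trajectory A B T u x0 x ->
  exists I : R, forall i : 'I_3, i != 0 -> x T i 0 = x0 i 0 + A i 0 * I.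
Proof.
move=> cAB T0 [cx xE].
exists (\int[@lebesgue_measure R]_(s in `[0, T]) x s 0 0) => i i0.
rewrite xE ?in_itv /= ?T0 ?lexx // !mxE; congr (_ + _).
under eq_Rintegral do rewrite star_leaf_dynamics //.
by rewrite RintegralZl //; exact/integrable_itv/within_continuous_coord.
Qed.

(** * The star is not structurally controllable *)

Lemma star_not_structurally_controllable (R : realType) :
  ~ structurally_controllable R star.
Proof.
move=> [A [B [cAB ctrl]]].
have reach (k : 'I_3) :
    exists I : R, forall i : 'I_3, i != 0 -> (i == k)%:R = A i 0 * I.
  have [u [x [_ trx xT]]] := ctrl 0 (delta_mx k 0) 1 ltr01.
  have [I xI] := star_leaf_shift cAB ler01 trx.
  by exists I => i i0; have := xI i i0; rewrite xT !mxE add0r andbT.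
(* Reaching the second leaf unit vector makes [A 2 0] nonzero, whereas reaching
   the first one needs [A 2 0 * I1 = 0] with [I1] nonzero. *)
have [I1 e1] := reach 1; have [I2 e2] := reach 2.
have A1 := e1 1 isT; have A2 := e1 2 isT; have A3 := e2 2 isT.
have /eqP := A2; rewrite eq_sym mulf_eq0 /= => /orP[/eqP z|/eqP z].
  by move: A3; rewrite z mul0r => /eqP; rewrite oner_eq0.
by move: A1; rewrite z mulr0 => /eqP; rewrite oner_eq0.
Qed.

(** * The star is not structurally ensemble controllable *)

(** The norm of a bound [h] that no control can beat pointwise is at most every
    error that some control achieves, hence zero, whatever [p] is. *)
Lemma Lp_controllable_lower_bound (R : realType) (n m : nat) (p : \bar R)
    (A : R -> 'M[R]_n) (B : R -> 'M[R]_(n, m)) (xT : R -> 'cV[R]_n)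
    (h : R -> R) :
  (1 <= p)%E -> Lp_controllable p A B -> {within `[0, 1], continuous xT} ->
  measurable_fun (`[0, 1]%classic : set R) h ->
  (forall s : R, s \in `[0, 1] -> 0 <= h s) ->
  (forall u x, ensemble_trajectory A B 1 u (cst 0) x ->
    forall s : R, s \in `[0, 1] -> h s <= euclidean_norm (x 1 s - xT s)) ->
  {ae @lebesgue_measure R, forall s : R, s \in `[0, 1] -> h s = 0}.
Proof.
move=> p1 ctrl cxT mh h0 hx.
have p0 : (0 < p)%E by exact: lt_le_trans p1.
pose H : R -> \bar R := ((fun s : R => (h s)%:E) \_ `[0, 1]).
have mH : measurable_fun [set: R] H.
  by apply/(measurable_restrictT _ _).1 => //; exact/measurable_EFinP.
have H0 : Lnorm (@lebesgue_measure R) p H = 0%E.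
  apply/eqP; rewrite eq_le Lnorm_ge0 andbT; apply/lee_addgt0Pr => e e0.
  have cst0 : {within `[0, 1], continuous (cst (0 : 'cV[R]_n) : R -> _)}.
    by apply: continuous_subspaceT => x; exact: cvg_cst.
  have [u [x [_ trx xe]]] := ctrl (cst 0) xT e 1 cst0 cxT e0 ltr01.
  rewrite add0e; apply/ltW/(le_lt_trans _ xe)/le_Lnorm => // s.
  rewrite /H /patch; case: ifPn => // sD; rewrite inE in sD.
  have hs := hx u x trx s sD.
  by rewrite !gee0_abs ?lee_fin ?h0 ?(le_trans (h0 s sD) hs).
have /filterS := Lnorm_eq0_eq0 (mu := @lebesgue_measure R) mH p0 H0.
apply=> s /(_ I) + sD.
by rewrite /H /patch mem_set // => -[].
Qed.

Lemma not_ae_itv01F (R : realType) (P : R -> Prop) :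
  {ae @lebesgue_measure R, forall s : R, s \in `[0, 1] -> P s} ->
  {ae @lebesgue_measure R, forall s : R, s \in `[0, 1] -> ~ P s} -> False.
Proof.
move=> aeP aeN.
have [N [mN N0 sN]] : {ae @lebesgue_measure R, forall s, s \notin `[0, 1]}.
  apply: filterS2 aeP aeN.
    exact: (ae_filter_ringOfSetsType lebesgue_measure).
  by move=> s Ps Ns; apply/negP => sD; exact: Ns sD (Ps sD).
have : (lebesgue_measure (`[0%R, 1%R]%classic : set R) <= lebesgue_measure N)%E.
  apply: le_measure; rewrite ?inE // => s sD.
  by apply: sN; apply/negP; rewrite negbK.
by rewrite N0 lebesgue_measure_itv /= lte01 sube0 lee_fin ler10.
Qed.

Lemma euclidean_norm3_leaves (R : realType) (v : 'cV[R]_3) (c : R) :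
  c <= v 1 0 ^+ 2 + v 2 0 ^+ 2 -> Num.sqrt c <= euclidean_norm v.
Proof.
move=> cv; apply: ler_wsqrtr; rewrite (bigD1 0) //= (bigD1 1) //= (bigD1 2) //=.
rewrite -[leLHS]add0r lerD ?sqr_ge0 // (le_trans cv) // lerD2l lerDl.
by apply: sumr_ge0 => i _; exact: sqr_ge0.
Qed.

Lemma star_not_structurally_ensemble_controllable (R : realType) :
  ~ structurally_ensemble_controllable R star.
Proof.
move=> [A [B [[cA _ cAB] [p [p1 ctrl]]]]].
pose a1 (s : R) := A s 1 0; pose a2 (s : R) := A s 2 0.
pose q (s : R) := a1 s ^+ 2 + a2 s ^+ 2.
have ca1 : {within `[0, 1], continuous a1} by exact: within_continuous_coord.
have ca2 : {within `[0, 1], continuous a2} by exact: within_continuous_coord.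
have cq : {within `[0, 1], continuous q}.
  by move=> s; apply: cvgD; apply: cvgM; (exact: ca1 || exact: ca2).
have q0 s : 0 <= q s by rewrite addr_ge0 ?sqr_ge0.
have leaves u x s : ensemble_trajectory A B 1 u (cst 0) x -> s \in `[0, 1] ->
    exists I, x 1 s 1 0 = a1 s * I /\ x 1 s 2 0 = a2 s * I.
  move=> trx sD; have [I xI] := star_leaf_shift (cAB s sD) ler01 (trx s sD).
  by exists I; split; rewrite xI //= mxE add0r.
(* First target: orthogonal to the line of reachable leaf states, and of the
   same length as the vector [(a1 s, a2 s)] that spans it. *)
have q_ae0 : {ae @lebesgue_measure R, forall s : R, s \in `[0, 1] -> q s = 0}.
  pose xT (s : R) : 'cV[R]_3 := \col_i [:: 0; - a2 s; a1 s]`_i.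
  have cxT : {within `[0, 1], continuous xT}.
    apply: within_continuous_mx => i j.
    have -> : (fun s : R => xT s i j) = fun s : R => [:: 0; - a2 s; a1 s]`_i.
      by apply/funext => s; rewrite mxE.
    case: i => [[|[|[|//]]] lti] /= s; first exact: cvg_cst.
    + by apply: cvgN; exact: ca2.
    + exact: ca1.
  have msq :
      measurable_fun (`[0, 1]%classic : set R) (fun s : R => Num.sqrt (q s)).
    apply: subspace_continuous_measurable_fun => // s.
    apply: continuous_comp; [exact: cq | exact: sqrt_continuous].
  suff : {ae @lebesgue_measure R,
      forall s : R, s \in `[0, 1] -> Num.sqrt (q s) = 0}.
    apply: filterS; first exact: (ae_filter_ringOfSetsType lebesgue_measure).
    move=> s sq /sq /eqP; rewrite sqrtr_eq0 => qs.
    by apply/le_anti; rewrite qs q0.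
  apply: (Lp_controllable_lower_bound p1 ctrl cxT msq) => [s _|u x trx s sD].
    exact: sqrtr_ge0.
  have [I [x1 x2]] := leaves u x s trx sD.
  apply: euclidean_norm3_leaves; rewrite !mxE x1 x2 /= -subr_ge0.
  (* By orthogonality the squared distance is [q s * (I ^+ 2 + 1)]. *)
  suff -> : (a1 s * I - - a2 s) ^+ 2 + (a2 s * I - a1 s) ^+ 2 - q s =
      q s * I ^+ 2.
    by rewrite mulr_ge0 ?sqr_ge0.
  by rewrite /q; ring.
(* Second target: the unit vector of the first leaf.  Where both leaf gains
   vanish it is missed by at least 1, and this is almost everywhere. *)
pose Z : set R := `[0, 1] `&` q @^-1` [set 0].
have mZ : measurable Z.
  have mq : measurable_fun (`[0, 1]%classic : set R) q.
    exact: subspace_continuous_measurable_fun.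
  by apply: mq.
apply: (@not_ae_itv01F R (fun s : R => q s = 0)) => //.
suff : {ae @lebesgue_measure R,
    forall s : R, s \in `[0, 1] -> \1_Z s = 0 :> R}.
  apply: filterS; first exact: (ae_filter_ringOfSetsType lebesgue_measure).
  move=> s Zs sD qs; have := Zs sD; rewrite indicE mem_set //.
  by move/eqP; rewrite oner_eq0.
apply: (@Lp_controllable_lower_bound _ _ _ p A B (cst (delta_mx 1 0)) \1_Z) => //.
- by apply: continuous_subspaceT => x; exact: cvg_cst.
move=> u x trx s sD; rewrite indicE.
have [/set_mem[_ /= qs]|_] := boolP (s \in Z); last by rewrite sqrtr_ge0.
have [I [x1 x2]] := leaves u x s trx sD.
have [a10 a20] : a1 s = 0 /\ a2 s = 0.
  have := qs; rewrite /q => /eqP.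
  by rewrite paddr_eq0 ?sqr_ge0 // !sqrf_eq0 => /andP[/eqP -> /eqP ->].
rewrite -[leLHS]sqrtr1; apply: euclidean_norm3_leaves.
by rewrite !mxE x1 x2 a10 a20 /=; lra.
Qed.

(** * The star is structurally averaged controllable *)

Lemma double_integrator_steering (R : realType) (T p q : R) : 0 < T ->
  exists V : {poly R}, [/\ V.[0] = 0, V^`().[0] = 0, V.[T] = p & V^`().[T] = q].
Proof.
move=> T0; have Tn0 : T != 0 by rewrite gt_eqF.
(* [a] and [b] solve [a T^2 + b T^3 = p] and [2 a T + 3 b T^2 = q]. *)
pose a := 3 * p / T ^+ 2 - q / T; pose b := q / T ^+ 2 - 2 * p / T ^+ 3.
exists (a *: 'X^2 + b *: 'X^3).
rewrite !poly.derivE !hornerE; split;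
  by rewrite /a /b /=; field.
Qed.

Section star_example.
Context (R : realType).

(** On the parameter interval, [w] is orthogonal to the constants: after
    averaging, [V_1] drops out of the hub and the first leaf, and [V_0] drops
    out of the second leaf. *)
Let w : {poly R} := 2 *: 'X - 1.

Definition star_A (s : R) : 'M[R]_3 :=
  \matrix_(i, j) (if j == 0 then [:: 0; 1; w]`_i else 0).[s].

Definition star_B (s : R) : 'M[R]_(3, 2) :=
  \matrix_(i, j) (if i == 0 then [:: 1; w]`_j else 0).[s].

Lemma star_example_compliant s : compliant star (star_A s) (star_B s).
Proof.
split=> [i j|i j]; rewrite /= mxE; last by case: ifP => //; rewrite horner0.
case: i => [[|[|[|//]]] lti] //=; rewrite ?hornerE //.
by case: j => [[|[|[|//]]] ltj] //=; rewrite ?hornerE.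
Qed.

Lemma star_example_ensemble_compliant : ensemble_compliant star star_A star_B.
Proof.
split=> [| |s _]; last exact: star_example_compliant.
- exact/continuous_subspaceT/continuous_poly_mx.
- exact/continuous_subspaceT/continuous_poly_mx.
Qed.

(** The state coordinates, as polynomials in time, of the system of parameter
    [s] started at [xi] and driven by the controls [V_j'']. *)
Definition star_state (V : 'I_2 -> {poly R}) (xi : 'cV[R]_3) (s : R)
    (i : 'I_3) : {poly R} :=
  let hub := (xi 0 0)%:P + (V 0)^`() + w.[s] *: (V 1)^`() in
  let hub_integral := xi 0 0 *: 'X + V 0 + w.[s] *: V 1 in
  [:: hub; (xi 1 0)%:P + hub_integral; (xi 2 0)%:P + w.[s] *: hub_integral]`_i.

Lemma star_state_trajectory (V : 'I_2 -> {poly R}) (xi : 'cV[R]_3) (T s : R) :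
  (forall j, (V j).[0] = 0) -> (forall j, (V j)^`().[0] = 0) ->
  trajectory (star_A s) (star_B s) T (fun t => \col_j (V j)^`()^`().[t]) xi
    (fun t => \col_i (star_state V xi s i).[t]).
Proof.
move=> V0 dV0.
have x0 : \col_i (star_state V xi s i).[0] = xi.
  apply/colP => i; rewrite mxE /star_state.
  by case: i => [[|[|[|//]]] lti] /=;
    rewrite !(hornerE, V0, dV0) /= ?mulr0 ?addr0; congr (xi _ _); apply/val_inj.
rewrite -[X in trajectory _ _ _ _ X _]x0; apply: poly_trajectory => t i.
have [->|i0] := eqVneq i 0.
  rewrite (star_hub_dynamics _ _ (star_example_compliant s)) !mxE /star_state /=.
  rewrite !poly.derivE !hornerE.
  by ring.
rewrite (star_leaf_dynamics _ _ (star_example_compliant s)) // !mxE /star_state.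
by case: i i0 => [[|[|[|//]]] lti] //= _;
  rewrite !poly.derivE !hornerE /= ?add0r //; ring.
Qed.

Lemma Rintegral01_add_quadratic_w (f : R -> R) (r q v : R) :
  {within `[0, 1], continuous f} ->
  \int[@lebesgue_measure R]_(s in `[0, 1])
    (f s + (r + q * w.[s] + v * w.[s] ^+ 2)) =
  \int[@lebesgue_measure R]_(s in `[0, 1]) f s + (r + v / 3).
Proof.
(* As [w' = 2], [w^2 / 4] and [w^3 / 6] are antiderivatives of [w] and [w^2]. *)
move=> cf; pose P := r *: 'X + (q / 4) *: w ^+ 2 + (v / 6) *: w ^+ 3.
under eq_Rintegral => s _.
  rewrite (_ : _ + _ * _ ^+ 2 = P^`().[s]); first over.
  by rewrite /P /w !poly.derivE !hornerE /=; field.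
rewrite Rintegral01_add_deriv_poly //; congr (_ + _).
by rewrite /P /w !hornerE /=; field.
Qed.

Lemma star_example_averaged_controllable : averaged_controllable star_A star_B.
Proof.
move=> x0 xi xT T cxi _ T0.
have cxi_ i : {within `[0, 1], continuous (fun s : R => xi s i 0)}.
  exact: within_continuous_coord.
pose mu := @lebesgue_measure R.
(* The state at time [T] under the zero control. *)
pose drift (s : R) (i : 'I_3) := [:: xi s 0 0; xi s 1 0 + T * xi s 0 0;
  xi s 2 0 + w.[s] * (T * xi s 0 0)]`_i.
have cdrift i : {within `[0, 1], continuous (drift^~ i)}.
  rewrite /drift; case: i => [[|[|[|//]]] lti] /=; first exact: cxi_.
  - move=> s; apply: cvgD; first exact: cxi_.
    by apply: cvgM; [exact: cvg_cst | exact: cxi_].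
  - move=> s; apply: cvgD; first exact: cxi_.
    apply: cvgM; first exact/continuous_subspaceT/continuous_horner.
    by apply: cvgM; [exact: cvg_cst | exact: cxi_].
pose miss i := xT i 0 - \int[mu]_(s in `[0, 1]) drift s i.
have [V0 [V00 dV00 V0T dV0T]] := double_integrator_steering (miss 1) (miss 0) T0.
have [V1 [V10 dV10 V1T dV1T]] := double_integrator_steering (3 * miss 2) 0 T0.
pose V (j : 'I_2) := [:: V0; V1]`_j.
exists (fun t => \col_j (V j)^`()^`().[t]).
exists (fun t s => \col_i (star_state V (xi s) s i).[t]); split.
- move=> j; rewrite (_ : (fun t => _) = EFin \o horner (V j)^`()^`()).
    exact/integrable_itv/continuous_subspaceT/continuous_horner.
  by apply/funext => t; rewrite /= mxE.
- move=> s _; apply: star_state_trajectory => j;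
    by case: j => [[|[|//]] ltj].
- apply/colP => i; rewrite mxE.
  have avg r q v : (forall s, (star_state V (xi s) s i).[T] =
        drift s i + (r + q * w.[s] + v * w.[s] ^+ 2)) -> r + v / 3 = miss i ->
      \int[mu]_(s in `[0, 1]) (\col_k (star_state V (xi s) s k).[T]) i 0 =
      xT i 0.
    move=> stateE rv; under eq_Rintegral do rewrite mxE stateE.
    by rewrite Rintegral01_add_quadratic_w // rv addrC subrK.
  case: i avg => [[|[|[|//]]] lti] avg.
  + apply: (avg (miss 0) 0 0) => [s|].
      by rewrite /star_state /drift /= !hornerE /= dV0T dV1T /miss; ring.
    by rewrite mul0r addr0; congr miss; exact/val_inj.
  + apply: (avg (miss 1) V1.[T] 0) => [s|].
      by rewrite /star_state /drift /= !hornerE /= V0T /miss; ring.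
    by rewrite mul0r addr0; congr miss; exact/val_inj.
  + apply: (avg 0 (miss 1) V1.[T]) => [s|].
      by rewrite /star_state /drift /= !hornerE /= V0T /miss; ring.
    rewrite V1T [RHS](_ : _ = miss 2); last by congr miss; exact/val_inj.
    by field.
Qed.

Lemma star_structurally_averaged_controllable :
  structurally_averaged_controllable R star.
Proof.
exists star_A, star_B; split; first exact: star_example_ensemble_compliant.
exact: star_example_averaged_controllable.
Qed.

End star_example.

Theorem proposition2p2 (R : realType) :
  exists (n m : nat) (G : sparsity_pattern n m),
    [/\ (0 < n)%N /\ (0 < m)%N,
        structurally_averaged_controllable R G,
        ~ structurally_controllable R G &
        ~ structurally_ensemble_controllable R G].
Proof.
exists 3, 2, star; split=> //.
- exact: star_structurally_averaged_controllable.
- exact: star_not_structurally_controllable.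
- exact: star_not_structurally_ensemble_controllable.
Qed.
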